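(* (1) Let $(S,\cdot,{}^{*})$ be a $*$-localisable semigroup and define unary operations ${}^{+},{}^{-}\colon S\to S$ by $x^{+}=xx^{*}$ and $x^{-}=x^{*}x$ for all $x\in S$. Then $(S,\cdot,{}^{+},{}^{-})$ is a localisable semigroup. (2) Conversely, let $(S,\cdot,{}^{+},{}^{-})$ be a localisable semigroup, assume that $S$ is regular, and suppose there exists an inverse mapping ${}^{*}\colon S\to S$, $x\mapsto x^{*}$, such that $x^{+}=xx^{*}$ and $x^{-}=x^{*}x$ for all $x\in S$. Then $(S,\cdot,{}^{*})$ is $*$-localisable.
   Context: A semigroup $S$ with a unary operation ${}^{*}$, written $(S,\cdot,{}^{*})$, is $*$-localisable if for all $x,y\in S$: (a) $xx^{*}x=x$; (b) $x^{*}xx^{*}=x^{*}$; (c) $(x(xx)^{*}x)^{*}=x(xx)^{*}x$; (d) $x(xyy^{*})^{*}=xy(xy)^{*}$; (e) $(x^{*}xy)^{*}y=(xy)^{*}xy$. A localisable semigroup is an algebra $(S,\cdot,+,-)$ of signature $(2,1,1)$ such that $(S,\cdot)$ is a semigroup and for all $x,y\in S$: (a) $x^{+}x=x$; (b) $(xy)^{+}=(xy^{+})^{+}$; (c) $x^{+}y^{+}=(x^{+}y)^{+}$; (d) $xx^{-}=x$; (e) $(xy)^{-}=(x^{-}y)^{-}$; (f) $x^{-}y^{-}=(xy^{-})^{-}$; (g) $(x^{+})^{-}=x^{+}$ and $(x^{-})^{+}=x^{-}$. A semigroup $S$ is regular if for every $x\in S$ there is $y\in S$ with $xyx=x$. An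 inverse mapping on $S$ is a map $x\mapsto x^{*}$ such that $xx^{*}x=x$ and $x^{*}xx^{*}=x^{*}$ for all $x\in S$. *)

(* Defs.v *)
From mathcomp Require Import all_boot.

Set Implicit Arguments.
Unset Strict Implicit.
Unset Printing Implicit Defensive.

Local Open Scope group_scope.

(* The carrier is a [magmaType] with associativity as an explicit axiom, since
   MathComp's [semigroupType] also bundles a [choiceType] structure, which an
   arbitrary semigroup need not come with. *)
Definition is_semigroup (S : magmaType) : Prop := @associative S *%g.

Record star_localisable (S : magmaType) (star : S -> S) : Prop := {
  star_localisable_semigroup : is_semigroup S;
  star_localisable_a : forall x, x * star x * x = x;
  star_localisable_b : forall x, star x * x * star x = star x;
  star_localisable_c :
    forall x, star (x * star (x * x) * x) = x * star (x * x) * x;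
  star_localisable_d :
    forall x y, x * star (x * y * star y) = x * y * star (x * y);
  star_localisable_e :
    forall x y, star (star x * x * y) * y = star (x * y) * x * y
}.

Record localisable (S : magmaType) (plus minus : S -> S) : Prop := {
  localisable_semigroup : is_semigroup S;
  localisable_a : forall x, plus x * x = x;
  localisable_b : forall x y, plus (x * y) = plus (x * plus y);
  localisable_c : forall x y, plus x * plus y = plus (plus x * y);
  localisable_d : forall x, x * minus x = x;
  localisable_e : forall x y, minus (x * y) = minus (minus x * y);
  localisable_f : forall x y, minus x * minus y = minus (x * minus y);
  localisable_g : forall x, minus (plus x) = plus x /\ plus (minus x) = minus x
}.

Definition regular (S : magmaType) : Prop :=
  forall x : S, exists y : S, x * y * x = x.

Definition inverse_mapping (S : magmaType) (star : S -> S) : Prop :=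
  (forall x, x * star x * x = x) /\ (forall x, star x * x * star x = star x).

(* Main.v *)
Require Import Defs.
From mathcomp Require Import all_boot.

Local Open Scope group_scope.

(** Both directions rest on how the star acts on idempotents.

    In a star-localisable semigroup, axiom (c) at an idempotent [f] reads
    [star f = f].  Axioms (d) and (e) then become the product laws (b) and (e)
    of a localisable semigroup, since [plus y] and [minus x] are idempotents.
    The laws (c) and (f) say that products of such idempotents are again fixed
    by [plus] and [minus], so what they need is that idempotents are closed
    under multiplication ([idempotentM]).  This follows from an absorption
    property: if [k] and [w * k] are idempotent, then (d) gives
    [w * (w * k) = w * k].  For [z = p * q] with [p] and [q] idempotent,
    absorption applies to [star z] with [k = p] and shows that [star z] is
    idempotent; then it applies to [z] with [k = star z] and shows that [z] is.

    Conversely, let the star induce localisable operations.  Axioms (d) and (e)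
    hold because [star z] absorbs [minus z] on its left and [plus z] on its
    right, and these projections factor when [z] is [x * plus y] or
    [minus x * y].  For (c), the element [x * star (x * x) * x] is idempotent,
    so it suffices that the star fixes every idempotent [e]
    ([star_idempotent_of_localisable]).  Now [plus e] is R-related and [minus e]
    is L-related to [e], so [minus e * plus e] lies in the D-class of [e].
    Being a product of projections it is idempotent, which forces
    [plus e * minus e = e].  Hence [e] is itself a projection, and the star
    fixes projections. *)

(** This is axiom (c) at [f], where [f * star (f * f) * f] collapses to [f]. *)
Lemma star_idempotent (S : magmaType) (star : S -> S) (f : S) :
  star_localisable star -> f * f = f -> star f = f.
Proof.
by move=> SL ff; have := star_localisable_c SL f; rewrite ff star_localisable_a.
Qed.

Lemma idempotent_mul_star (S : magmaType) (star : S -> S) :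
  is_semigroup S -> inverse_mapping star ->
  forall x, (x * star x) * (x * star x) = x * star x.
Proof. by move=> A [sa _] x; rewrite A sa. Qed.

Lemma idempotent_star_mul (S : magmaType) (star : S -> S) :
  is_semigroup S -> inverse_mapping star ->
  forall x, (star x * x) * (star x * x) = star x * x.
Proof. by move=> A [_ sb] x; rewrite A sb. Qed.

Lemma star_localisable_inverse_mapping (S : magmaType) (star : S -> S) :
  star_localisable star -> inverse_mapping star.
Proof. by move=> SL; case: SL. Qed.

(** In axiom (d) for [w] and [k] the stars disappear, because [k] and [w * k]
    are both fixed by the star. *)
Lemma idempotent_absorb (S : magmaType) (star : S -> S) (w k : S) :
  star_localisable star -> k * k = k -> (w * k) * (w * k) = w * k ->
  w * (w * k) = w * k.
Proof.
move=> SL kk wk; have A := star_localisable_semigroup SL.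
have := star_localisable_d SL w k.
by rewrite (star_idempotent _ _ _ SL kk) -(A w k k) kk
           (star_idempotent _ _ _ SL wk) wk.
Qed.

(** The key point of the first direction: [idempotent_absorb] is used once for
    [star (p * q)] and once for [p * q]. *)
Lemma idempotentM (S : magmaType) (star : S -> S) (p q : S) :
  star_localisable star -> p * p = p -> q * q = q ->
  (p * q) * (p * q) = p * q.
Proof.
move=> SL pp qq; have A := star_localisable_semigroup SL.
have [sa sb] := star_localisable_inverse_mapping _ _ SL.
set z := p * q; set h := star z.
have ph : p * h = z * h.
  have := star_localisable_d SL p q.
  by rewrite (star_idempotent _ _ _ SL qq) -(A p q q) qq.
have hzh : h * z * h = h by apply: sb.
have zhz : z * h * z = z by apply: sa.
have hph : h * p * h = h by rewrite -A ph A.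
have hhp : h * (h * p) = h * p.
  by apply: (idempotent_absorb _ _ _ _ SL pp); rewrite A hph.
have hh : h * h = h.
  (* Multiplying [h * h * p = h * p] on the right by [h] cancels [p]. *)
  by rewrite -[in X in h * X]hph A hhp hph.
have zzh : z * (z * h) = z * h.
  by apply: (idempotent_absorb _ _ _ _ SL hh); rewrite A zhz.
by rewrite -[in X in z * X]zhz A zzh zhz.
Qed.

Lemma localisable_of_star_localisable (S : magmaType) (star : S -> S) :
  star_localisable star ->
  localisable (fun x : S => x * star x) (fun x : S => star x * x).
Proof.
move=> SL; have A := star_localisable_semigroup SL.
have inv := star_localisable_inverse_mapping _ _ SL.
have [sa sb] := inv.
have pI := idempotent_mul_star _ _ A inv.
have mI := idempotent_star_mul _ _ A inv.
have sI f : f * f = f -> star f = f by apply: star_idempotent.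
have D x y : x * star (x * (y * star y)) = x * y * star (x * y).
  by rewrite A; apply: star_localisable_d.
have E := star_localisable_e SL.
have plusM x y :
    x * y * star (x * y) = x * (y * star y) * star (x * (y * star y)).
  (* Axiom (d) has the same left-hand side for [y] and for [y * star y]. *)
  by rewrite -(D x y) -(D x (y * star y)) (sI _ (pI y)) pI.
have minusM x y :
    star (x * y) * (x * y) = star (star x * x * y) * (star x * x * y).
  have Em := E (star x * x) y; rewrite (sI _ (mI x)) mI in Em.
  by rewrite [LHS]A [RHS]A -(E x y) -Em.
split=> //=.
- move=> x y; rewrite plusM.
  have I := idempotentM _ _ _ _ SL (pI x) (pI y).
  by rewrite (sI _ I) I.
- by move=> x; rewrite A sa.
- move=> x y; rewrite minusM.
  have I := idempotentM _ _ _ _ SL (mI x) (mI y).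
  by rewrite (sI _ I) I.
- by move=> x; rewrite (sI _ (pI x)) (sI _ (mI x)) pI mI.
Qed.

(** Every idempotent [e] equals [plus e * minus e], which is a projection by
    the product law (c), and the star fixes projections. *)
Lemma star_idempotent_of_localisable
    (S : magmaType) (plus minus star : S -> S) (e : S) :
  localisable plus minus -> inverse_mapping star ->
  (forall x, plus x = x * star x) -> (forall x, minus x = star x * x) ->
  e * e = e -> star e = e.
Proof.
move=> L inv plusE minusE ee; have A := localisable_semigroup L.
have [sa sb] := inv.
have plusI x : plus x * plus x = plus x.
  by rewrite (localisable_c L) (localisable_a L).
have plus_minus x : plus (minus x) = minus x by case: (localisable_g L x).
have minus_plus x : minus (plus x) = plus x by case: (localisable_g L x).
set p := plus e; set q := minus e.
have ep : e * p = p by rewrite /p plusE A ee.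
have pe : p * e = e by apply: localisable_a L _.
have eq_ : e * q = e by apply: localisable_d L _.
have qe : q * e = q by rewrite /q minusE -A ee.
have qpI : (q * p) * (q * p) = q * p.
  by rewrite -[q]plus_minus (localisable_c L) plusI.
have qpq : q * p * q = q.
  (* Multiplying [qpI] on the right by [e] turns [q * p] into [q]. *)
  have qpe : q * p * e = q by rewrite -A pe qe.
  by rewrite -[in X in _ * X = _]qpe A qpI qpe.
have pq : p * q = e by rewrite -ep -[in LHS]eq_ -!A (A q p q) qpq eq_.
have plus_e : plus e = e.
  have : p * plus q = plus (p * q) by apply: localisable_c L _ _.
  by rewrite plus_minus pq.
have minus_e : minus e = e by rewrite -{1}plus_e minus_plus.
by rewrite -(sb e) -minusE minus_e -plusE.
Qed.

Lemma star_localisable_of_localisable (S : magmaType) (plus minus star : S -> S) :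
  localisable plus minus -> inverse_mapping star ->
  (forall x, plus x = x * star x) -> (forall x, minus x = star x * x) ->
  star_localisable star.
Proof.
move=> L inv plusE minusE; have A := localisable_semigroup L.
have [sa sb] := inv.
have plus_minus x : plus (minus x) = minus x by case: (localisable_g L x).
have minus_plus x : minus (plus x) = plus x by case: (localisable_g L x).
split=> //.
- move=> x; apply: star_idempotent_of_localisable L inv plusE minusE _.
  set u := star (x * x).
  have uxxu : u * (x * x) * u = u by apply: sb.
  have -> : x * u * x * (x * u * x) = x * (u * (x * x) * u) * x by rewrite !A.
  by rewrite uxxu.
- move=> x y; rewrite -A -!plusE (localisable_b L) (plusE (x * _)).
  set z := x * plus y; set w := star z.
  (* The law (f), applied to the projection [plus y]. *)
  have zE : minus z = minus x * plus y.
    by rewrite -[X in minus x * X]minus_plus (localisable_f L) minus_plus.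
  have wE : w = minus x * plus y * w by rewrite -zE minusE sb.
  by rewrite {1}wE !A (localisable_d L).
- move=> x y; rewrite -[RHS]A -!minusE (localisable_e L) (minusE (_ * y)).
  set z := minus x * y; set w := star z.
  (* The law (c), applied to the projection [minus x]. *)
  have zE : plus z = minus x * plus y.
    by rewrite -[X in X * plus y]plus_minus (localisable_c L) plus_minus.
  have wE : w = w * (minus x * plus y) by rewrite -zE plusE A sb.
  by rewrite {1}wE -!A (localisable_a L).
Qed.

Theorem theorem8p5 :
  (forall (S : magmaType) (star : S -> S),
     star_localisable star ->
     localisable (fun x : S => x * star x) (fun x : S => star x * x)) /\
  (forall (S : magmaType) (plus minus : S -> S),
     localisable plus minus ->
     regular S ->
     forall star : S -> S,
       inverse_mapping star ->
       (forall x : S, plus x = x * star x) ->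
       (forall x : S, minus x = star x * x) ->
       star_localisable star).
Proof.
split; first exact: localisable_of_star_localisable.
by move=> S plus minus L _ star; apply: star_localisable_of_localisable.
Qed.
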